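(* For every countable order type $\alpha$ (of a chain), the class $\mathbb{J}_{\alpha}$ contains a join-semilattice $Q_{\alpha}$ which embeds as a join-subsemilattice in every join-subsemilattice of $[\omega]^{<\omega}$ belonging to $\mathbb{J}_{\alpha}$. This $Q_\alpha$ is equal to: (a) $1+\alpha$ if $\alpha$ is finite; (b) $I_{<\omega}(S_{\alpha})$, where $S_{\alpha}$ is some sierpinskisation of $\alpha$ and $\omega$, if $\alpha$ is countably infinite.
   Context: $\mathbb{J}$ is the class of join-semilattices having a least element. An ideal of a poset $P$ is a non-empty up-directed initial segment (down-closed subset); $J(P)$ is the set of ideals of $P$ ordered by inclusion. $I(\alpha)$ is the order type of the chain of all initial segments (including the empty one and the whole chain), ordered by inclusion, of a chain of type $\alpha$. $\mathbb{J}_{\alpha}$ is the class of $P\in\mathbb{J}$ such that $J(P)$ contains a chain of type $I(\alpha)$ (i.e. has a subset which is a chain of this type). A join-subsemilattice is a subset closed under binary joins with the induced order; $P$ embeds as a join-subsemilattice in $P'$ if $P$ is isomorphic to a join-subsemilattice of $P'$. $[\omega]^{<\omega}$ is the set of finite subsets of $\omega$ ordered by inclusion. $1+\alpha$ is the chain obtained by adding a new least element to $\alpha$. For a poset $S$, $I_{<\omega}(S)$ is the set of finitely generated initial segments of $S$ (including $\emptyset$), ordered by inclusion. A sierpinskisation of a countably infinite order type $\alpha$ and $\omega$ is a poset $(S,\leq)$ whose order $\leq$ is the intersection of two linear orders on $S$, one of type $\alpha$, the other of type $\omega$. *)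

(* Defs.v *)
From HB Require Import structures.
From mathcomp Require Import all_boot all_order finmap.
From mathcomp Require Import boolp classical_sets functions cardinality.

Set Implicit Arguments.
Unset Strict Implicit.
Unset Printing Implicit Defensive.

Import Order.TTheory.
Local Open Scope classical_set_scope.
Local Open Scope order_scope.

HB.instance Definition _ (T : choiceType) (A : set T) :=
  SubChoice.copy (set_type A) {x : T | x \in A}.
HB.instance Definition _ d (T : porderType d) (A : set T) :=
  Order.SubChoice_isSubPOrder.Build d T (fun x => x \in A) d (set_type A).

Fact fset_display : Order.disp_t. Proof. by []. Qed.

Section FsetOrder.
Variable K : choiceType.

Lemma fset_le_anti : antisymmetric (@fsubset K).
Proof. by move=> A B AB; apply/eqP; rewrite eqEfsubset. Qed.

Lemma fset_le_trans : transitive (@fsubset K).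
Proof. by move=> B A C; apply: fsubset_trans. Qed.

HB.instance Definition _ := Order.Le_isPOrder.Build fset_display {fset K}
  (@fsubset_refl K) fset_le_anti fset_le_trans.

Lemma fset_leUx (A B C : {fset K}) :
  ((A `|` B)%fset <= C) = (A <= C) && (B <= C).
Proof. exact: fsubUset. Qed.

HB.instance Definition _ := Order.POrder_isJoinSemilattice.Build fset_display
  {fset K} fset_leUx.
End FsetOrder.

Section OrderIso.
Context d1 d2 (P : porderType d1) (Q : porderType d2).

Definition order_embeds := exists f : P -> Q, {mono f : x y / x <= y}.

Definition order_isomorphic :=
  exists f : P -> Q, bijective f /\ {mono f : x y / x <= y}.
End OrderIso.

(* The carrier may be empty; a join-subsemilattice with a least element need
   not contain the least element of the ambient semilattice. *)
Record joinSubsemilattice d (T : joinSemilatticeType d) := JoinSubsemilattice {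
  join_carrier : set T;
  join_carrierU : forall x y,
    join_carrier x -> join_carrier y -> join_carrier (x `|` y)
}.

Section JoinSubsemilatticeTheory.
Context d (T : joinSemilatticeType d) (A : joinSubsemilattice T).

Definition join_sort : Type := set_type (join_carrier A).

HB.instance Definition _ := Order.POrder.on join_sort.

Lemma join_sub_subproof (x y : join_sort) :
  val x `|` val y \in join_carrier A.
Proof. by apply/mem_set/join_carrierU; apply/set_mem/valP. Qed.

Definition join_sub (x y : join_sort) : join_sort :=
  exist _ (val x `|` val y) (join_sub_subproof x y).

Lemma join_subP (x y z : join_sort) :
  (join_sub x y <= z) = (x <= z) && (y <= z).
Proof. exact: leUx. Qed.

HB.instance Definition _ := Order.POrder_isJoinSemilattice.Build d join_sort
  join_subP.
End JoinSubsemilatticeTheory.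

Coercion join_sort : joinSubsemilattice >-> Sortclass.

Definition embeds_as_join_subsemilattice d1 d2 (P : joinSemilatticeType d1)
    (P' : joinSemilatticeType d2) : Prop :=
  exists A : joinSubsemilattice P', order_isomorphic P A.

Section InitialSegments.
Context d (P : porderType d).

Definition initial_segment (A : set P) : Prop :=
  forall x y, A x -> y <= x -> A y.

Definition initial_segments : set (set P) := [set A | initial_segment A].

Definition up_directed (A : set P) : Prop :=
  forall x y, A x -> A y -> exists z, [/\ A z, x <= z & y <= z].

Definition ideals : set (set P) :=
  [set A | [/\ A !=set0, up_directed A & initial_segment A]].

Definition fg_initial_segment (A : set P) : Prop :=
  exists2 F : set P, finite_set F & A = down F.

Lemma fg_initial_segmentU (A B : set P) :
  fg_initial_segment A -> fg_initial_segment B ->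
  fg_initial_segment (Order.join A B).
Proof.
move=> [F Ffin ->] [G Gfin ->]; exists (F `|` G)%classic.
  by rewrite finite_setU.
apply/seteqP; split => x.
  by case=> -[y [Fy xy]]; exists y; split => //; [left|right].
by case=> y [[Fy|Gy] xy]; [left|right]; exists y.
Qed.

(* I_{<omega}(P): the join is the union, inherited from the powerset of P. *)
Definition fg_initial_segments : joinSubsemilattice (set P) :=
  JoinSubsemilattice fg_initial_segmentU.
End InitialSegments.

Arguments initial_segments {d} P.
Arguments ideals {d} P.
Arguments fg_initial_segments {d} P.

Definition has_least d (P : porderType d) : Prop := exists m : P, forall x, m <= x.

Definition in_J_alpha d (C : orderType d) d' (P : joinSemilatticeType d') : Prop :=
  has_least P /\ order_embeds (initial_segments C) (ideals P).

(* The chain 1 + C, with None as the new least element. *)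
Definition add_least (C : Type) : Type := option C.

Section AddLeast.
Context d (C : orderType d).

HB.instance Definition _ := Choice.on (add_least C).

Definition add_least_le (x y : add_least C) : bool :=
  match x, y with
  | None, _ => true
  | Some _, None => false
  | Some a, Some b => a <= b
  end.

Lemma add_least_le_refl : reflexive add_least_le.
Proof. by case=> /=. Qed.

Lemma add_least_le_anti : antisymmetric add_least_le.
Proof. by move=> [a|] [b|] //= /le_anti ->. Qed.

Lemma add_least_le_trans : transitive add_least_le.
Proof. by move=> [b|] [a|] [c|] //=; apply: le_trans. Qed.

HB.instance Definition _ := Order.Le_isPOrder.Build d (add_least C)
  add_least_le_refl add_least_le_anti add_least_le_trans.

Lemma add_least_le_total : total (<=%O : rel (add_least C)).
Proof. by move=> [a|] [b|] //; apply: le_total. Qed.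

HB.instance Definition _ := Order.POrder_isTotal.Build d (add_least C)
  add_least_le_total.
End AddLeast.

Definition linear_order (T : Type) (r : rel T) : Prop :=
  [/\ reflexive r, antisymmetric r, transitive r & total r].

Definition has_order_type (T : Type) (r : rel T) d (C : orderType d) : Prop :=
  exists f : T -> C, bijective f /\ forall x y, r x y = (f x <= f y).

Definition sierpinskisation d (S : porderType d) d1 (C1 : orderType d1)
    d2 (C2 : orderType d2) : Prop :=
  exists r1 r2 : rel S,
    [/\ linear_order r1 /\ has_order_type r1 C1,
        linear_order r2 /\ has_order_type r2 C2
      & forall x y : S, (x <= y) = r1 x y && r2 x y].

(* Main.v *)
Require Import Defs.
From HB Require Import structures.
From mathcomp Require Import all_boot all_order finmap.
From mathcomp Require Import boolp classical_sets functions cardinality.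

(** Take [S] to be [C] ordered by [u <= v] and [n u <= n v], for a bijection
[n : C -> nat] (for [n = 0] if [C] is finite).  A chain of ideals of
[A] indexed by the initial segments of [C] yields points [x c] and members
[a c] of [A] such that [x c \in a c], and [x u \in a v] only if [u <= v]; a given
[a v] contains finitely many [x u].  If [f : C -> C] is such that
[x (f u) \in a (f v)] implies [u <= v] in [S], then sending [X] to the join of
the [a (f c)], [c] in [X], embeds [I_{<omega}(S)] in [A].  Such an [f] is built
greedily along [n].  If [C] has a nonempty subset [E] without minimum, any [n]
works, the values of [f] descending in [E] so fast that [x (f u) \in a (f v)]
only for [u = v].  If [C] is well-ordered, [n] must be increasing on each
[omega]-block of [C]; [f] moves every point upwards within its block, and fixes
the last block when that is finite. *)

Set Implicit Arguments.
Unset Strict Implicit.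
Unset Printing Implicit Defensive.

Import Order.TTheory.
Local Open Scope classical_set_scope.
Local Open Scope order_scope.

(** * Enumerations by rank, and greedy sequences *)

(** The number [n y] counts the predecessors of [y]. *)
Lemma rank_bijective (T : choiceType) (r : T -> T -> Prop) :
  (forall x, ~ r x x) -> (forall x y z, r x y -> r y z -> r x z) ->
  (forall x y, x <> y -> r x y \/ r y x) ->
  (forall y, finite_set [set x | r x y]) -> infinite_set [set: T] ->
  exists2 n : T -> nat, bijective n & forall x y, r x y -> (n x < n y)%N.
Proof.
move=> rirr rtrans rtot rfin Tinf.
pose X y := fset_set [set x | r x y].
have inX x y : (x \in X y) <-> r x y.
  by rewrite in_fset_set //; split=> [/set_mem|H]; last exact/mem_set.
pose n y := #|` X y|.
have nlt x y : r x y -> (n x < n y)%N.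
  move=> rxy; apply: fproper_ltn_card; rewrite fproperE; apply/andP; split.
    by apply/fsubsetP => z /inX rzx; apply/inX/(rtrans _ x).
  by apply/negP => /fsubsetP /(_ x); move/(_ (proj2 (inX x y) rxy))/inX/rirr.
have ninj : injective n.
  move=> x y nxy; apply: contrapT => /rtot[] /nlt; by rewrite nxy ltnn.
have nunb k : exists y, (k < n y)%N.
  apply: contrapT => nok; apply: Tinf.
  apply: (@sub_finite_set _ _ (n @^-1` `I_k.+1)).
    move=> y _ /=; rewrite ltnS leqNgt; apply/negP => H; apply: nok.
    by exists y.
  by apply: finite_preimage; [move=> x y _ _; exact: ninj|exact: finite_II].
have nsurj k : exists y, n y = k.
  (* The predecessors of [y] have [n y] distinct ranks below [n y], hence every such rank, [k]
     included. *)
  have [y ky] := nunb k.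
  have [] := @uniq_min_size _ [seq n x | x <- X y] (iota 0 (n y)).
  - by rewrite map_inj_uniq.
  - by move=> _ /mapP[x /inX rxy ->]; rewrite mem_iota /= add0n; exact: nlt.
  - by rewrite size_iota size_map.
  move=> _ /(_ k); rewrite mem_iota add0n ky /= => /mapP[x _ ->].
  by exists x.
have [m mK] := choice nsurj.
by exists n => //; exists m => // x; apply: ninj.
Qed.

(** Recursion on all earlier values: a step may assume [P] of them, and has to relate each of them
    to the new value by [G]. *)
Lemma greedy_choice (T : Type) (t0 : T) (P : nat -> T -> Prop)
    (G : nat -> nat -> T -> T -> Prop) :
  (forall k (h : nat -> T), (forall j, (j < k)%N -> P j (h j)) ->
     exists2 y, P k y & forall j, (j < k)%N -> G j k (h j) y) ->
  exists h : nat -> T, forall k,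
    P k (h k) /\ forall j, (j < k)%N -> G j k (h j) (h k).
Proof.
move=> step.
have step' (x : nat * (nat -> T)) : exists y,
    (forall j, (j < x.1)%N -> P j (x.2 j)) ->
    P x.1 y /\ forall j, (j < x.1)%N -> G j x.1 (x.2 j) y.
  have [H|H] := pselect (forall j, (j < x.1)%N -> P j (x.2 j)).
    by have [y Py Gy] := step _ _ H; exists y.
  (* A default for histories that violate [P]; these never occur along [h]. *)
  by exists t0.
have [Y YP] := choice step'.
pose s := fix s k := if k is k'.+1 then
  rcons (s k') (Y (k', nth t0 (s k'))) else [::].
have ss k : size (s k) = k by elim: k => //= k IH; rewrite size_rcons IH.
pose h k := Y (k, nth t0 (s k)).
have sh k j : (j < k)%N -> nth t0 (s k) j = h j.
  elim: k => //= k IH; rewrite ltnS leq_eqVlt nth_rcons ss.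
  by case/orP => [/eqP ->|jk]; [rewrite ltnn eqxx|rewrite jk IH].
have hP : forall k, P k (h k) /\ forall j, (j < k)%N -> G j k (h j) (h k).
  elim/ltn_ind => k IH.
  have := YP (k, nth t0 (s k)); case=> [j /= jk|/= Pk Gk].
    by rewrite sh //; have [] := IH j jk.
  by split=> // j jk; have := Gk j jk; rewrite sh.
by exists h.
Qed.

(** * Thinning finitary relations on a chain *)

Section Thinning.
Context d (C : orderType d).
Implicit Types (u v c : C) (R : C -> C -> Prop).

(* Instances of [R u v] will be [x u \in a v]. *)
Definition finitary_below R :=
  (forall u v, R u v -> u <= v) /\ forall v, finite_set [set u | R u v].

(** The conclusion is the order of [sierpinski_poset n], introduced below. *)
Definition thinnable (n : C -> nat) := forall R, finitary_below R ->
  exists f : C -> C, forall u v, R (f u) (f v) -> u <= v /\ (n u <= n v)%N.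

Lemma thinnable_descending (E : set C) (n : C -> nat) :
  E !=set0 -> (forall x, E x -> exists2 y, E y & y < x) -> bijective n ->
  thinnable n.
Proof.
move=> [e0 Ee0] Edesc [m nK mK] R [Rle Rfin].
have below (F : set C) : finite_set F ->
    exists2 e, E e & forall z, F z -> E z -> e < z.
  move=> /finite_seqP[s ->]; elim: s => [|a s [e Ee IH]]; first by exists e0.
  have [Ea|nEa] := pselect (E a); last first.
    exists e => // z /=; rewrite inE => /orP[/eqP -> //|zs]; exact: IH.
  have Em : E (Order.min e a) by case: leP.
  have [e' Ee' e'm] := Edesc _ Em; exists e' => // z /=; rewrite inE.
  move: e'm; rewrite lt_min => /andP[e'e e'a] /orP[/eqP -> //|zs Ez].
  exact: lt_trans e'e (IH _ zs Ez).
have [h hP] : exists h : nat -> C, forall k, E (h k) /\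
    forall j, (j < k)%N -> h k < h j /\ ~ R (h k) (h j).
  apply: (greedy_choice e0 (P := fun=> E)
            (G := fun j k z y => y < z /\ ~ R y z)) => k h hE.
  (* Lying strictly below all elements of [E] in this finite set, [e] is below the earlier values
     and is none of the points related to them. *)
  have [|e Ee elt] := below (\bigcup_(j in `I_k) (h j |` [set u | R u (h j)])).
    by apply: bigcup_finite => [|j _]; [exact: finite_II|rewrite finite_setU].
  exists e => // j jk; split; first by apply: elt (hE _ jk); exists j => //; left.
  move=> Rej; suff : e < e by rewrite ltxx.
  by apply: elt => //; exists j => //; right.
exists (h \o n) => u v /= Ruv.
(* If [u] comes first, [h] descends while [R] only goes up; if [v] comes first, the choice of [h]
   excludes [R]. *)
case: (ltngtP (n u) (n v)) => [uv|vu|/(can_inj nK) ->//].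
  have [_ /(_ _ uv)[lt_vu _]] := hP (n v).
  by have := lt_le_trans lt_vu (Rle _ _ Ruv); rewrite ltxx.
by have [_ /(_ _ vu)[_]] := hP (n u).
Qed.


(* The upper half of the [omega]-block of [u]. *)
Definition block u : set C :=
  [set v | u <= v /\ finite_set [set z | u <= z <= v]].

Lemma block_refl u : block u u.
Proof.
split=> //; apply: sub_finite_set (finite_set1 u) => z /= /andP[uz zu].
by apply/eqP; rewrite eq_le zu.
Qed.

Lemma block_sub u u' v v' : u <= u' -> u' <= v' -> v' <= v ->
  block u v -> block u' v'.
Proof.
move=> uu' uv' vv' [_ ufin]; split=> //.
apply: sub_finite_set ufin => z /= /andP[u'z zv'].
by rewrite (le_trans uu' u'z) (le_trans zv' vv').
Qed.

Lemma block_trans u v w : block u v -> block v w -> block u w.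
Proof.
move=> [uv uvfin] [vw vwfin]; split; first exact: le_trans uv vw.
have : finite_set ([set z | u <= z <= v] `|` [set z | v <= z <= w]).
  by rewrite finite_setU.
apply: sub_finite_set => z /= /andP[uz zw].
by have [zv|/ltW vz] := leP z v; [left; rewrite uz|right; rewrite vz].
Qed.

(** * Well-ordered chains and their [omega]-blocks *)

Section WellOrder.
Context (wo : forall E : set C, E !=set0 ->
  exists2 m, E m & forall x, E x -> m <= x).

(** All these [u] lie between the least of them and [v], which is a finite interval. *)
Lemma finite_coblock v : finite_set [set u | block u v].
Proof.
have [|m [mv mfin] mmin] := wo (E := [set u | block u v]).
  by exists v; exact: block_refl.
apply: sub_finite_set mfin => u /= buv; rewrite (mmin _ buv) /=.
by case: buv.
Qed.

(** If the block were finite, the least point above [u] outside it would be at finite distance from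
    [u], hence inside it. *)
Lemma infinite_block u :
  infinite_set [set v | u <= v] -> infinite_set (block u).
Proof.
move=> uinf bfin.
have [|e [ue ne] emin] := wo (E := [set v | u <= v /\ ~ block u v]).
  apply: contrapT => no; apply: uinf; apply: sub_finite_set bfin => v /= uv.
  by apply: contrapT => nb; apply: no; exists v.
apply: ne; split=> //.
have : finite_set (block u `|` [set e]) by rewrite finite_setU.
apply: sub_finite_set => z /= /andP[uz ze].
have [->|nze] := eqVneq z e; [by right|left; apply: contrapT => nb].
by move: nze; rewrite eq_le ze emin.
Qed.

Lemma thinnable_block_monotone (n : C -> nat) : bijective n ->
  (forall u v, block u v -> (n u <= n v)%N) -> thinnable n.
Proof.
move=> [m nK mK] nmono R [Rle Rfin].
have [C0|/nonemptyPn C0] := pselect ([set: C] !=set0); last first.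
  by exists id => u; have : [set: C] u by []; rewrite C0.
have [t0 _] := C0.
(* By well-ordering, [fin u] means that the whole block of [u] is finite; it is then the last one,
   and its points stay fixed. *)
pose fin u := finite_set [set v | u <= v].
have fin_le u v : u <= v -> fin u -> fin v.
  by move=> uv; apply: sub_finite_set => z /= /(le_trans uv).
have fin_block u v : block u v -> fin v -> fin u.
  move=> [uv bf] vf.
  have : finite_set ([set z | u <= z <= v] `|` [set z | v <= z]).
    by rewrite finite_setU.
  apply: sub_finite_set => z /= uz.
  by have [zv|/ltW vz] := leP z v; [left; rewrite uz|right].
have [h hP] : exists h : nat -> C, forall k,
    (block (m k) (h k) /\ (fin (m k) -> h k = m k)) /\
    forall j, (j < k)%N -> (fin (m k) \/ ~ R (h k) (h j)) /\
      (block (m j) (m k) -> h j < h k).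
  apply: (greedy_choice t0
    (P := fun k y => block (m k) y /\ (fin (m k) -> y = m k))
    (G := fun j k z y => (fin (m k) \/ ~ R y z) /\ (block (m j) (m k) -> z < y)))
    => k h hP.
  have [fk|nfk] := pselect (fin (m k)).
    exists (m k); first by split=> //; exact: block_refl.
    move=> j jk; split; [by left|move=> b].
    have [_ ->] := hP _ jk; last exact: fin_block b fk.
    have [mjk _] := b; rewrite lt_neqAle mjk andbT; apply/eqP => /(can_inj mK) jk'.
    by rewrite jk' ltnn in jk.
  (* Outside the first sets, [R y (h j)] fails. Outside the intervals, finite since [h j] is in
     [block (m j)], a point [y] above [m k] exceeds [h j] as soon as [m j <= m k]. *)
  pose F := \bigcup_(j in `I_k)
    ([set u | R u (h j)] `|` [set z | m j <= z <= h j]).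
  have Ffin : finite_set F.
    apply: bigcup_finite => [|j jk]; first exact: finite_II.
    by rewrite finite_setU; split=> //; have [[]] := hP _ jk.
  have /infinite_setN0[y [by_ nFy]] :=
    infinite_setD (infinite_block nfk) Ffin.
  exists y => // j jk; split; first by right=> Ryj; apply: nFy; exists j => //; left.
  move=> [mjk _]; rewrite ltNge; apply/negP => yj; apply: nFy; exists j => //.
  by right; rewrite /= yj andbT; apply: le_trans mjk _; case: by_.
exists (h \o n) => u v /= Ruv.
have blk w : block w (h (n w)) by have [[]] := hP (n w); rewrite nK.
have huv := Rle _ _ Ruv.
have uv : u <= v.
  rewrite leNgt; apply/negP => vu.
  have [bvu|nbvu] := pselect (block v u).
    have nvu : (n v < n u)%N.
      rewrite ltn_neqAle nmono // andbT; apply/eqP => /(can_inj nK) E.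
      by rewrite E ltxx in vu.
    have [_ /(_ _ nvu)[_]] := hP (n u); rewrite !nK => /(_ bvu).
    by rewrite ltNge huv.
  (* From [v <= u <= h (n u) <= h (n v)], the point [u] lies in the block of [v]. *)
  apply: nbvu; apply: (block_sub _ _ _ (blk v)) => //; first exact: ltW.
  by apply: le_trans huv; have [] := blk u.
split=> //; rewrite leqNgt; apply/negP => vu.
have [_ /(_ _ vu)[]] := hP (n u); rewrite nK => -[fu|//] _.
(* In the remaining case only finitely many points lie above [u], so [v] is in its block, where [n]
   is monotone. *)
have : block u v.
  by split=> //; apply: sub_finite_set fu => z /= /andP[].
by move/nmono; rewrite leqNgt vu.
Qed.

(** The running maximum [K] of [e] along each block is monotone there; points are ranked by [K],
    ties being broken by the order of [C]. Since [e x <= K x], each point has finitely many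
    predecessors. *)
Lemma thinnable_of_well_order (e : C -> nat) : injective e ->
  infinite_set [set: C] -> exists2 n : C -> nat, bijective n & thinnable n.
Proof.
move=> einj Cinf.
pose K c := (\max_(u <- fset_set [set u | block u c]) e u)%N.
have leK u v : block u v -> (e u <= K v)%N.
  move=> buv; apply: (@leq_bigmax_seq _ _ xpredT) => //.
  by rewrite in_fset_set; [exact/mem_set|exact: finite_coblock].
have Kmono u v : block u v -> (K u <= K v)%N.
  move=> buv; apply/bigmax_leqP_seq => w.
  rewrite in_fset_set; last exact: finite_coblock.
  by move=> /set_mem wu _; apply/leK/(block_trans wu).
pose r u v := (K u < K v)%N \/ K u = K v /\ u < v.
have [n nbij nmono] : exists2 n : C -> nat, bijective n &
    forall x y, r x y -> (n x < n y)%N.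
  apply: rank_bijective => //.
  - by move=> x [|[_]]; rewrite ?ltnn ?ltxx.
  - move=> x y z [xy|[xy lxy]] [yz|[yz lyz]]; rewrite /r.
    + by left; apply: ltn_trans yz.
    + by left; rewrite -yz.
    + by left; rewrite xy.
    + by right; split; [rewrite xy|apply: lt_trans lyz].
  - move=> x y xy; rewrite /r; have [Kxy|Kyx|Kxy] := ltngtP (K x) (K y).
    + by left; left.
    + by right; left.
    + by have [lxy|lyx|//] := ltgtP x y; [left|right]; right.
  - move=> y; have : finite_set (e @^-1` `I_(K y).+1).
      by apply: finite_preimage (finite_II _) => ? ? _ _; exact: einj.
    apply: sub_finite_set => x rxy /=; rewrite ltnS.
    apply: leq_trans (leK x x (block_refl x)) _.
    by case: rxy => [/ltnW|[->]].
exists n => //; apply: thinnable_block_monotone => // u v buv.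
have [->//|uv] := eqVneq u v; apply/ltnW/nmono.
have := Kmono _ _ buv; rewrite leq_eqVlt => /orP[/eqP E|]; [right|by left].
by split=> //; rewrite lt_neqAle uv; case: buv.
Qed.
End WellOrder.

Lemma exists_thinnable (e : C -> nat) : injective e -> infinite_set [set: C] ->
  exists2 n : C -> nat, bijective n & thinnable n.
Proof.
move=> einj Cinf.
have [wo|nwo] := pselect (forall E : set C, E !=set0 ->
    exists2 m, E m & forall x, E x -> m <= x).
  exact: thinnable_of_well_order einj Cinf.
have [E [E0 Edesc]] : exists E : set C, E !=set0 /\
    forall x, E x -> exists2 y, E y & y < x.
  apply: contrapT => noE; apply: nwo => E E0; apply: contrapT => nomin.
  apply: noE; exists E; split=> // x Ex; apply: contrapT => nx; apply: nomin.
  exists x => // y Ey; rewrite leNgt; apply/negP => yx; apply: nx.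
  by exists y.
(* Ranking by [e] closes the gaps in its range. *)
have [n nbij _] : exists2 n : C -> nat, bijective n &
    forall x y, (e x < e y)%N -> (n x < n y)%N.
  apply: rank_bijective => //.
  - by move=> x; rewrite ltnn.
  - by move=> x y z; exact: ltn_trans.
  - by move=> x y xy; case: (ltngtP (e x) (e y)) => [||/einj]; [left|right|].
  - by move=> y; apply: finite_preimage (finite_II _) => ? ? _ _; exact: einj.
by exists n => //; apply: thinnable_descending E0 Edesc nbij.
Qed.

End Thinning.

(** * The sierpinskisation and its finitely generated initial segments *)

Lemma set_type_leP T (F : set (set T)) (X Y : F) :
  reflect (val X `<=` val Y) (X <= Y).
Proof. by apply: (iffP idP); rewrite -subsetEset. Qed.

Definition set_type_intro T (F : set T) x (Fx : F x) : F :=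
  exist (fun x => x \in F) x (mem_set Fx).

(** An alias that records [n], so that the points of [C] can carry a second order. *)
Definition sierpinski_poset d (C : orderType d) (n : C -> nat) : Type := C.

Section SierpinskiPoset.
Context d (C : orderType d) (n : C -> nat).
Local Notation S := (sierpinski_poset n).

HB.instance Definition _ := Choice.on S.

Definition sierpinski_le (x y : S) := ((x : C) <= y) && (n x <= n y)%N.

Fact sierpinski_le_refl : reflexive sierpinski_le.
Proof. by move=> x; rewrite /sierpinski_le lexx leqnn. Qed.

Fact sierpinski_le_anti : antisymmetric sierpinski_le.
Proof.
by move=> x y /andP[/andP[xy _] /andP[yx _]]; apply/eqP; rewrite eq_le xy.
Qed.

Fact sierpinski_le_trans : transitive sierpinski_le.
Proof.
move=> y x z /andP[xy nxy] /andP[yz nyz].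
by rewrite /sierpinski_le (le_trans xy yz) (leq_trans nxy nyz).
Qed.

HB.instance Definition _ := Order.Le_isPOrder.Build d S
  sierpinski_le_refl sierpinski_le_anti sierpinski_le_trans.

Lemma sierpinski_leE (x y : S) : (x <= y) = ((x : C) <= y) && (n x <= n y)%N.
Proof. by []. Qed.

Lemma sierpinskisation_bijective : bijective n -> sierpinskisation S C nat.
Proof.
move=> nbij; exists (<=%O : rel C), (fun x y : S => (n x <= n y)%N).
split=> //; split.
- by split; [exact: (@lexx _ C)|exact: (@le_anti _ C)
    |exact: (@le_trans _ C)|exact: (@le_total _ C)].
- by exists id; split=> //; exists id.
- split=> [x|x y xy|y x z|x y]; [exact: leqnn| |exact: leq_trans|exact: leq_total].
  by apply: (bij_inj nbij); apply/anti_leq.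
- by exists n.
Qed.

Lemma finite_down_fg (X : set S) : (forall v : S, finite_set (down [set v])) ->
  fg_initial_segment X -> finite_set X.
Proof.
move=> downfin [F Ffin ->].
apply: (@sub_finite_set _ _ (\bigcup_(v in F) down [set v])).
  by move=> x [y [Fy xy]]; exists y => //; exists y.
exact: bigcup_finite.
Qed.

Lemma fg_initial_segment0 : fg_initial_segment (set0 : set S).
Proof.
by exists set0 => //; apply/seteqP; split=> // x [y []].
Qed.

Lemma fg_initial_segment1 (v : S) : fg_initial_segment (down [set v]).
Proof. by exists [set v]. Qed.

Lemma fg_initial_segment_le (X : set S) u v :
  fg_initial_segment X -> X v -> u <= v -> X u.
Proof.
by move=> [F _ ->] [w [Fw vw]] uv; exists w; split=> //; apply: le_trans vw.
Qed.

Local Notation Q := (fg_initial_segments S).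

Definition fg_Sub (X : set S) (HX : fg_initial_segment X) : Q :=
  set_type_intro HX.

Lemma fg_valP (X : Q) : fg_initial_segment (val X).
Proof. exact/set_mem/valP. Qed.

Lemma fg_leP (X Y : Q) : (X <= Y) <-> (val X `<=` val Y).
Proof. by rewrite -subsetEset. Qed.

(** An initial segment [X] of [C] is sent to the ideal of the members of [Q] included in [X]; the
    principal ones among them recover [X]. *)
Lemma in_J_alpha_fg_initial_segments : in_J_alpha C Q.
Proof.
split.
  by exists (fg_Sub fg_initial_segment0) => X; apply/fg_leP.
have idealP (X : set C) : initial_segment X ->
    ideals Q [set Y : Q | val Y `<=` (X : set S)].
  move=> Xis; split.
  - by exists (fg_Sub fg_initial_segment0).
  - move=> Y Z YX ZX; exists (Y `|` Z); split; [|exact: leUl|exact: leUr].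
    by move=> z [/YX|/ZX].
  - by move=> Y Z YX /fg_leP ZY; apply: subset_trans YX.
exists (fun X : initial_segments C =>
  set_type_intro (idealP (val X) (set_mem (valP X)))).
move=> X X'; apply/idP/idP => [/set_type_leP /= H|/set_type_leP XX'];
  apply/set_type_leP; last by move=> Y YX; apply: subset_trans XX'.
move=> v Xv.
pose Y := fg_Sub (fg_initial_segment1 v).
have YX : val Y `<=` (val X : set S).
  move=> u [w [-> /andP[uv _]]]; exact: (set_mem (valP X)) Xv uv.
have YX' : val Y `<=` (val X' : set S) := H Y YX.
by apply: YX'; exists v.
Qed.

End SierpinskiPoset.

(** * Separating points in a chain of ideals, and the embedding *)

Section Witnesses.
Context d (C : orderType d) (A : joinSubsemilattice {fset nat}).

Lemma up_directed_bound (I : set A) (s : seq nat) : I !=set0 -> up_directed I ->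
  (forall k, k \in s -> exists2 b, I b & k \in val b) ->
  exists2 b, I b & {subset s <= val b}.
Proof.
move=> [b0 Ib0] Idir; elim: s => [|k s IH] cov; first by exists b0.
have [b Ib kb] := cov k (mem_head _ _).
have [|b' Ib' sb'] := IH.
  by move=> j js; apply: cov; rewrite inE js orbT.
have [c [Ic bc b'c]] := Idir _ _ Ib Ib'; exists c => // j.
rewrite inE => /orP[/eqP ->|/sb' jb']; first exact: (fsubsetP bc).
exact: (fsubsetP b'c).
Qed.

(* A chain [I_X] of ideals indexed by the initial segments of [C] is strictly
   increasing, and so are the unions [\bigcup I_X]; [x c] is a point gained by
   the union at [c], and [a c] a member of the ideal that contains it. *)
Lemma chain_witnesses : in_J_alpha C A ->
  exists (m : A) (x : C -> nat) (a : C -> A),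
    [/\ forall c, x c \notin val m, forall c, x c \in val (a c)
      & finitary_below (fun u v => x u \in val (a v))].
Proof.
move=> [[m mleast] [phi phimono]].
have ltP c : initial_segment [set z : C | z < c].
  by move=> y z /= yc /le_lt_trans; apply.
have leP' c : initial_segment [set z : C | z <= c].
  by move=> y z /= yc /le_trans; apply.
pose L c : initial_segments C := set_type_intro (ltP c).
pose M c : initial_segments C := set_type_intro (leP' c).
pose I c : set A := val (phi (L c)).
pose J c : set A := val (phi (M c)).
have idI c : ideals A (I c) by apply/set_mem/valP.
have idJ c : ideals A (J c) by apply/set_mem/valP.
have JI u v : u < v -> J u `<=` I v.
  move=> uv; apply/set_type_leP; rewrite phimono; apply/set_type_leP => z /=.
  by move=> zu; apply: le_lt_trans uv.
have JnI c : ~ (J c `<=` I c).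
  move/set_type_leP; rewrite phimono => /set_type_leP /(_ c) /=.
  by rewrite ltxx lexx => /(_ isT).
have IJ c : I c `<=` J c.
  by apply/set_type_leP; rewrite phimono; apply/set_type_leP => z /= /ltW.
have xa c : exists p : nat * A,
    [/\ J c p.2, p.1 \in val p.2 & forall b, I c b -> p.1 \notin val b].
  (* Otherwise each point of [b] lies in a member of [I c]; as [b] is finite, a single member
     contains it, so [b] is in [I c]. *)
  apply: contrapT => no; apply: (JnI c) => b Jb.
  have [I0 Idir Iis] := idI c.
  have [k kb|b' Ib' bb'] := up_directed_bound (s := enum_fset (val b)) I0 Idir.
    apply: contrapT => nob; apply: no; exists (k, b); split=> // b' Ib' /=.
    by apply/negP => kb'; apply: nob; exists b'.
  by apply: Iis Ib' _; apply/fsubsetP.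
have [p pP] := choice xa.
exists m, (fst \o p), (snd \o p); split=> [c|c|] /=.
- have [_ _ h] := pP c; apply: h; have [[b Ib] _ Iis] := idI c.
  exact: Iis _ _ Ib (mleast b).
- by have [] := pP c.
split=> [u v|v].
  move=> xuv; rewrite leNgt; apply/negP => vu.
  have [_ _ h] := pP u; have [Jv _ _] := pP v.
  by have := h _ (JI _ _ vu _ Jv); rewrite xuv.
(* The points are distinct: for [u < w], that of [u] lies in a member of [I w], that of [w] in
   none. *)
apply: (@finite_preimage _ _ [set` val (p v).2] (fst \o p)); last exact: finite_fset.
move=> u w _ _ /= xuw.
have sep u' w' : u' < w' -> (p u').1 <> (p w').1.
  move=> uw' E; have [_ _ h] := pP w'; have [Ju xu _] := pP u'.
  by have := h _ (JI _ _ uw' _ Ju); rewrite -E xu.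
by case: (ltgtP u w) => // /sep; [move/(_ xuw)|move/(_ (esym xuw))].
Qed.

(** Starting from [m] provides a member of [A] even for empty [X]. *)
Lemma finite_union_in (m : A) (a : C -> A) (X : set C) : finite_set X ->
  exists t : A, forall k,
    k \in val t <-> k \in val m \/ exists2 c, X c & k \in val (a c).
Proof.
move=> /finite_seqP[s ->]; elim: s => [|c s [t tP]].
  by exists m => k; split=> [|[//|[c]]]; [left|].
exists (t `|` a c) => k.
have -> : (k \in val (t `|` a c)) = (k \in val t) || (k \in val (a c)).
  exact: in_fsetU.
split=> [/orP[/tP[km|[e es ke]]|kc]|[km|[e]]].
- by left.
- by right; exists e => //; rewrite /= inE es orbT.
- by right; exists c => //; rewrite /= inE eqxx.
- by apply/orP; left; apply/tP; left.
- rewrite /= inE => /orP[/eqP ->|es] ke; first by rewrite ke orbT.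
  by apply/orP; left; apply/tP; right; exists e.
Qed.

Lemma embeds_fg_initial_segments (n : C -> nat) : thinnable n ->
  (forall v : sierpinski_poset n, finite_set (down [set v])) ->
  in_J_alpha C A ->
  embeds_as_join_subsemilattice (fg_initial_segments (sierpinski_poset n)) A.
Proof.
move=> thin downfin /chain_witnesses[m [x [a [xm xa Rab]]]].
have [f fP] := thin _ Rab.
set Q := fg_initial_segments _.
have finQ (X : Q) : finite_set (val X : set C).
  exact: finite_down_fg downfin (fg_valP X).
(* Joining over all of the finite set [X], not over generators, turns unions into joins. *)
have [Phi PhiP] := choice (fun X : Q => finite_union_in m (a \o f) (finQ X)).
have PhiU X Y : Phi (X `|` Y) = Phi X `|` Phi Y.
  apply/val_inj/fsetP => k.
  have -> : (k \in val (Phi X `|` Phi Y)) =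
      (k \in val (Phi X)) || (k \in val (Phi Y)).
    exact: in_fsetU.
  apply/idP/orP => [/PhiP[km|[c [Xc|Yc] kc]]|].
  - by left; apply/PhiP; left.
  - by left; apply/PhiP; right; exists c.
  - by right; apply/PhiP; right; exists c.
  by case=> /PhiP[km|[c cX kc]]; apply/PhiP; [left|right; exists c; first by left
     |left|right; exists c; first by right].
have Phimono : {mono Phi : X Y / X <= Y}.
  move=> X Y; apply/idP/idP => [PXY|XY].
    apply/fg_leP => c Xc.
    (* The point [x (f c)] tests membership of [c]: it avoids [m], so it comes from some [a (f e)]
       with [e] in [Y], and thinning gives [c <= e]. *)
    have /(fsubsetP PXY)/PhiP[] : x (f c) \in val (Phi X).
      by apply/PhiP; right; exists c => //; exact: xa.
      by rewrite (negPf (xm _)).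
    move=> [e Ye /fP ce]; apply: fg_initial_segment_le (fg_valP Y) Ye _.
    by rewrite sierpinski_leE; case: ce => -> ->.
  by rewrite -(join_r XY) PhiU leUl.
have imU : forall s t, range Phi s -> range Phi t -> range Phi (s `|` t).
  by move=> _ _ [X _ <-] [Y _ <-]; exists (X `|` Y).
exists (JoinSubsemilattice imU).
have imP X : range Phi (Phi X) by exists X.
exists (fun X => set_type_intro (imP X)); split; last by move=> X Y; exact: Phimono.
have inv (t : JoinSubsemilattice imU) : exists X, Phi X = val t.
  by have [X _ XE] := set_mem (valP t); exists X.
have [psi psiP] := choice inv.
exists psi => [X|t]; last exact/val_inj/psiP.
have : Phi (psi (set_type_intro (imP X))) = Phi X by rewrite psiP.
by move/(inc_inj Phimono).
Qed.

End Witnesses.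

(** * The finite case and the conclusion *)

Lemma order_isomorphic_surj d1 d2 (P : porderType d1) (P' : porderType d2)
    (g : P -> P') : {mono g : x y / x <= y} -> (forall y, exists x, g x = y) ->
  order_isomorphic P' P.
Proof.
move=> gmono /choice[h hK]; exists h; split.
  by exists g => // x; apply: (inc_inj gmono); rewrite hK.
by move=> x y; rewrite -gmono !hK.
Qed.

Lemma order_isomorphic_refl d (P : porderType d) : order_isomorphic P P.
Proof. by exists id; split=> //; exists id. Qed.

(** With [n] constant the poset is the chain [C], where the greatest generator suffices; the empty
    segment is the added least element. *)
Lemma fg_initial_segments_finite_chain d (C : orderType d) :
  order_isomorphic (fg_initial_segments (sierpinski_poset (fun _ : C => 0%N)))
    (add_least C).
Proof.
set n := fun _ => _.
pose g (o : add_least C) : fg_initial_segments (sierpinski_poset n) :=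
  if o is Some c then fg_Sub (fg_initial_segment1 (c : sierpinski_poset n))
  else fg_Sub (@fg_initial_segment0 _ _ n).
have leE (u v : sierpinski_poset n) : (u <= v) = ((u : C) <= v).
  by rewrite sierpinski_leE andbT.
apply: (@order_isomorphic_surj _ _ _ _ g).
  move=> [u|] [v|]; apply/idP/idP => //.
  - move=> /fg_leP /(_ u)[|w [-> ]]; first by exists u.
    by rewrite leE.
  - move=> uv; apply/fg_leP => w [_ [-> wu]]; exists v; split=> //.
    by apply: le_trans wu _; rewrite leE.
  - by apply/negP => /fg_leP /(_ u)[]; exists u.
  - by apply/fg_leP.
move=> X; have [F Ffin XF] := fg_valP X.
have [o oP] : exists o : add_least C, val (g o) = down F.
  move: Ffin => /finite_seqP[s ->] {X XF F}.
  elim: s => [|c s [o oP]].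
    by exists None; apply/seteqP; split=> // x [y []].
  have downU : down [set` c :: s] =
      down [set` s] `|` down [set c] :> set (sierpinski_poset n).
    apply/seteqP; split=> x.
      move=> [y []] /=; rewrite inE => /orP[/eqP ->|ys] xy; [right|left];
      by [exists c|exists y].
    move=> [] [y [ys xy]]; exists y; split=> //=; rewrite inE.
      by rewrite ys orbT.
    by rewrite ys eqxx.
  rewrite downU -oP; case: o oP => [e|] _ /=; last first.
    by exists (Some c); apply/seteqP; split=> x; [right|case].
  have [ec|/ltW ce] := leP e c; [exists (Some c)|exists (Some e)].
    apply/seteqP; split=> x /=; first by right.
    case=> // -[y [-> xe]]; exists c; split=> //.
    by apply: le_trans xe _; rewrite leE.
  apply/seteqP; split=> x /=; first by left.
  case=> // -[y [-> xe]]; exists e; split=> //.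
  by apply: le_trans xe _; rewrite leE.
by exists o; apply/val_inj; rewrite oP XF.
Qed.

Theorem mainTheorem3 (d : Order.disp_t) (C : orderType d)
    (countableC : countable [set: C]%classic) :
  exists (dQ : Order.disp_t) (Q : joinSemilatticeType dQ),
    [/\ in_J_alpha C Q,
        forall A : joinSubsemilattice {fset nat},
          in_J_alpha C A -> embeds_as_join_subsemilattice Q A,
        finite_set [set: C]%classic -> order_isomorphic Q (add_least C)
      & infinite_set [set: C]%classic ->
          exists (dS : Order.disp_t) (S : porderType dS),
            sierpinskisation S C nat /\
            order_isomorphic Q (fg_initial_segments S)].
Proof.
have [Cfin|Cinf] := pselect (finite_set [set: C]).
  exists _, (fg_initial_segments (sierpinski_poset (fun _ : C => 0%N))); split=> //.
  - exact: in_J_alpha_fg_initial_segments.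
  - move=> A; apply: embeds_fg_initial_segments.
      by move=> R [Rle _]; exists id => u v /Rle.
    by move=> v; apply: sub_finite_set Cfin.
  - by move=> _; exact: fg_initial_segments_finite_chain.
have /countable_injP[e einj] := countableC.
have {}einj : injective e by move=> x y; apply: einj; exact: mem_setT.
have [n nbij nthin] := exists_thinnable einj Cinf.
exists _, (fg_initial_segments (sierpinski_poset n)); split=> // [||_].
- exact: in_J_alpha_fg_initial_segments.
- move=> A; apply: embeds_fg_initial_segments nthin _ => v.
  (* Points below [v] in the sierpinskisation have rank at most [n v]. *)
  have : finite_set (n @^-1` `I_(n v).+1).
    by apply: finite_preimage (finite_II _) => ? ? _ _; apply: (bij_inj nbij).
  by apply: sub_finite_set => u [_ [-> /andP[_]]].
exists _, (sierpinski_poset n); split; first exact: sierpinskisation_bijective.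
exact: order_isomorphic_refl.
Qed.
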